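(* The Poisson manifolds $(W_3,e_7)$, $(W_3,e_8)$ and $(W_3,e_{13})$, where $W_3=\mathrm{Tot}(\mathcal O_{\mathbb P^1}(-3)\oplus\mathcal O_{\mathbb P^1}(1))$ and the $e_i$ are the Poisson structures specified in the context, are pairwise nonisomorphic.
   Context: $W_3$ is obtained by gluing $U=\mathbb C^3_{\{z,u_1,u_2\}}$ and $V=\mathbb C^3_{\{\xi,v_1,v_2\}}$ by $(\xi,v_1,v_2)=(z^{-1},z^3u_1,z^{-1}u_2)$ where $z,\xi\neq0$. Write $\partial_0=\partial/\partial z$, $\partial_1=\partial/\partial u_1$. The global holomorphic Poisson structures on $W_3$ are given on $U$ by $$e_7=u_1\,\partial_0\wedge\partial_1,\quad e_8=zu_1\,\partial_0\wedge\partial_1,\quad e_{13}=u_1u_2\,\partial_0\wedge\partial_1 .$$ Poisson manifolds $(W_3,\pi)$ and $(W_3,\pi')$ are isomorphic if there is a biholomorphism $\phi:W_3\to W_3$ with $\phi_*\pi=\pi'$. *)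

(* Defs.v *)
From HB Require Import structures.
From mathcomp Require Import all_boot all_order all_algebra.
From mathcomp Require Import complex ring.
From mathcomp Require Import all_classical all_reals all_analysis.

Set Implicit Arguments.
Unset Strict Implicit.
Unset Printing Implicit Defensive.

Import Order.TTheory GRing.Theory Num.Theory.
Import numFieldNormedType.Exports.

Local Open Scope classical_set_scope.
Local Open Scope ring_scope.
Local Open Scope complex_scope.
Local Open Scope quotient_scope.

(* The field C is generic only to keep unification fast; it is meant to be
   [Cplx R], the complex numbers, defined at the end of the file. *)
Section W3.
Variable C : numFieldType.
Local Notation C3 := 'rV[C]_3.

Definition vec3 (a b c : C) : C3 := \row_(i < 3) [:: a; b; c]`_i.

Lemma vec3E (a b c : C) :
  ((vec3 a b c 0 0 = a) * (vec3 a b c 0 1 = b) * (vec3 a b c 0 2 = c))%type.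
Proof. by rewrite /vec3 !mxE. Qed.

Lemma vec3_eta (p : C3) : p = vec3 (p 0 0) (p 0 1) (p 0 2).
Proof.
apply/rowP => -[[|[|[|//]]] hi]; rewrite /vec3 !mxE /=;
  by congr (p _ _); apply/val_inj.
Qed.

(* The change of coordinates (z, u1, u2) |-> (z^-1, z^3 u1, z^-1 u2) on z != 0.
   Its inverse (xi, v1, v2) |-> (xi^-1, xi^3 v1, xi^-1 v2) is given by the same
   formula, so a single function serves for both directions. *)
Definition glue (p : C3) : C3 :=
  vec3 (p 0 0)^-1 (p 0 0 ^+ 3 * p 0 1) ((p 0 0)^-1 * p 0 2).

Lemma glue_neq0 (p : C3) : (glue p 0 0 != 0) = (p 0 0 != 0).
Proof. by rewrite /glue vec3E invr_eq0. Qed.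

Lemma glueK (p : C3) : p 0 0 != 0 -> glue (glue p) = p.
Proof.
move=> p0; rewrite [RHS]vec3_eta /glue !vec3E invrK.
by congr vec3; field.
Qed.


(* The two charts are indexed by bool: true is U, false is V. *)
Local Notation charts := {b : bool & C3}.

Definition glued (x y : charts) : bool :=
  if tag x == tag y then tagged x == tagged y
  else (tagged x 0 0 != 0) && (tagged y == glue (tagged x)).

Lemma glued_refl : reflexive glued.
Proof. by move=> x; rewrite /glued !eqxx. Qed.

Lemma glued_sym : symmetric glued.
Proof.
move=> [a p] [b q]; rewrite /glued /= [b == a]eq_sym.
case: ifP => _; first by rewrite eq_sym.
by apply/andP/andP => -[h /eqP ->]; rewrite glue_neq0 glueK.
Qed.

Lemma glued_trans : transitive glued.
Proof.
move=> [b q] [a p] [c r]; rewrite /glued /=.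
case: a b c => -[] [] //=.
all: try by move=> /eqP -> /eqP ->.
all: try by move=> /eqP ->.
all: try by move=> /andP[h /eqP ->] /eqP <-; rewrite h eqxx.
all: by move=> /andP[h /eqP ->] /andP[_ /eqP ->]; rewrite glueK.
Qed.

Canonical glued_equiv := EquivRel glued glued_refl glued_sym glued_trans.

(* W_3, with the quotient topology of the disjoint union of the charts. *)
Definition W3 : topologicalType := quotient_topology {eq_quot glued}.

Definition incl (b : bool) (p : C3) : W3 :=
  \pi_({eq_quot glued}) (existT _ b p : charts).

(* The coordinates in chart b; meaningful on the image of chart b only. *)
Definition coord (b : bool) (w : W3) : C3 :=
  let x := repr (w : {eq_quot glued}) in
  if tag x == b then tagged x else glue (tagged x).

Lemma incl_repr (w : W3) : exists b p, w = incl b p.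
Proof.
have := reprK (w : {eq_quot glued}).
by case: (repr _) => b p /= <-; exists b, p.
Qed.

Lemma inclK (b : bool) : cancel (incl b) (coord b).
Proof.
move=> p; rewrite /coord /incl.
have /eqquotP : repr (\pi_({eq_quot glued}) (existT _ b p : charts)) =
  existT _ b p %[mod {eq_quot glued}] by rewrite reprK.
by case: (repr _) => a q; rewrite /= /glued /=; case: ifP => _;
  [move/eqP | case/andP=> _ /eqP].
Qed.

Lemma incl_glue (b : bool) (p : C3) :
  p 0 0 != 0 -> incl (~~ b) (glue p) = incl b p.
Proof.
move=> p0; apply/eqquotP; rewrite /= /glued /=.
by case: b => /=; rewrite glue_neq0 p0 glueK ?eqxx.
Qed.


(* A map is holomorphic if it is continuous and complex differentiable in all
   pairs of charts. *)
Definition holomorphic (phi : W3 -> W3) : Prop :=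
  continuous phi /\
  forall (a b : bool) (p : C3), range (incl b) (phi (incl a p)) ->
    differentiable (coord b \o phi \o incl a) p.

Definition biholomorphism (phi : W3 -> W3) : Prop :=
  holomorphic phi /\
  exists psi : W3 -> W3, [/\ holomorphic psi, cancel phi psi & cancel psi phi].

(* A bivector \sum_(i, j) A i j d_i (x) d_j is encoded by the skew-symmetric
   matrix A.  Since 'J f p acts on row vectors ('d f p v = v *m 'J f p), the
   differential of f at p maps A to the following matrix. *)
Definition push2 (f : C3 -> C3) (p : C3) (A : 'M[C]_3) : 'M[C]_3 :=
  ('J f p)^T *m A *m 'J f p.

Definition pd (i : 'I_3) (f : C3 -> C) (p : C3) : C :=
  'D_('e_i : C3) f p.

(* Holomorphic Poisson structures on W_3: a bivector field in each chart, the
   two agreeing under the change of coordinates, with vanishing Schouten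
   bracket [pi, pi] = 0 (the Jacobi identity for the Poisson bracket). *)
Record poisson := Poisson {
  bivec :> bool -> C3 -> 'M[C]_3;
  poisson_holo : forall (b : bool) (p : C3), differentiable (bivec b) p;
  poisson_skew : forall (b : bool) (p : C3), (bivec b p)^T = - bivec b p;
  poisson_glue : forall (b : bool) (p : C3), p 0 0 != 0 ->
    bivec (~~ b) (glue p) = push2 glue p (bivec b p);
  poisson_jacobi : forall (b : bool) (p : C3) (i j k : 'I_3),
    \sum_(l < 3) (bivec b p i l * pd l (fun q => bivec b q j k) p
                + bivec b p j l * pd l (fun q => bivec b q k i) p
                + bivec b p k l * pd l (fun q => bivec b q i j) p) = 0
}.

(* phi_* pi = pi' for a biholomorphism phi: at every point w the differential
   of phi sends the bivector pi_w to pi'_(phi w), written in any charts around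
   w and phi w. *)
Definition pushforward_eq (phi : W3 -> W3) (pi pi' : poisson) : Prop :=
  forall (a b : bool) (p : C3), range (incl b) (phi (incl a p)) ->
    pi' b (coord b (phi (incl a p))) =
    push2 (coord b \o phi \o incl a) p (pi a p).

Definition poisson_isomorphic (pi pi' : poisson) : Prop :=
  exists phi : W3 -> W3, biholomorphism phi /\ pushforward_eq phi pi pi'.

(* d_i /\ d_j, with the convention d_i (x) d_j - d_j (x) d_i. *)
Definition wedge (i j : 'I_3) : 'M[C]_3 := delta_mx i j - delta_mx j i.

Lemma is_diff_coord (i : 'I_3) (p : C3) :
  is_diff p (fun q : C3 => q 0 i : C) (fun q => q 0 i).
Proof.
apply: DiffDef; first exact: differentiable_coord.
have lin : linear (fun q : C3 => q 0 i : C) by move=> a u v; rewrite !mxE.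
pose linM := GRing.isLinear.Build _ _ _ _ _ lin.
pose linL : {linear C3 -> C} := HB.pack (fun q : C3 => q 0 i : C) linM.
by have -> := @diff_lin _ _ _ linL p (@coord_continuous _ _ _ 0 i).
Qed.

Lemma is_diffZl (V W : normedModType C) (f df : V -> C) (w : W) (p : V) :
  is_diff p f df -> is_diff p (fun q => f q *: w) (fun q => df q *: w).
Proof.
move=> fp; apply: DiffDef; first exact: differentiableZl.
by rewrite diffZl // diff_val.
Qed.

Lemma is_diffV (V : normedModType C) (f df : V -> C) (p : V) : f p != 0 ->
  is_diff p f df -> is_diff p (fun q => (f q)^-1) (fun q => - (f p) ^- 2 * df q).
Proof.
move=> f0 fp; apply: DiffDef; first exact: differentiableV.
by rewrite diffV // diff_val.
Qed.

Lemma is_diff_mul (V : normedModType C) (f g df dg : V -> C) (p : V) :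
  is_diff p f df -> is_diff p g dg ->
  is_diff p (fun q => f q * g q) (fun q => f p * dg q + g p * df q).
Proof. by move=> fp gp; apply: is_diff_eq. Qed.

Lemma is_diff_vec3 (f g h df dg dh : C3 -> C) (p : C3) :
  is_diff p f df -> is_diff p g dg -> is_diff p h dh ->
  is_diff p (fun q => vec3 (f q) (g q) (h q))
            (fun q => vec3 (df q) (dg q) (dh q)).
Proof.
have E a b c : vec3 a b c = a *: vec3 1 0 0 + b *: vec3 0 1 0 + c *: vec3 0 0 1.
  apply/rowP => -[[|[|[|//]]] hi]; rewrite /vec3 !mxE /=;
    by rewrite !mulr0 !mulr1 ?addr0 ?add0r.
move=> fp gp hp.
rewrite (_ : (fun q => vec3 (f q) _ _) = (fun q => f q *: vec3 1 0 0)
  + (fun q => g q *: vec3 0 1 0) + (fun q => h q *: vec3 0 0 1)); last first.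
  by apply/funext => q; exact: E.
have H := is_diffD (is_diffD (is_diffZl (vec3 1 0 0) fp)
  (is_diffZl (vec3 0 1 0) gp)) (is_diffZl (vec3 0 0 1) hp).
by apply: (is_diff_eq H); apply/funext => q; rewrite [RHS]E.
Qed.

Definition dglue (p q : C3) : C3 :=
  vec3 (- (p 0 0) ^- 2 * q 0 0)
       (3 * p 0 0 ^+ 2 * p 0 1 * q 0 0 + p 0 0 ^+ 3 * q 0 1)
       (- (p 0 0) ^- 2 * p 0 2 * q 0 0 + (p 0 0)^-1 * q 0 2).

Lemma is_diff_glue (p : C3) : p 0 0 != 0 -> is_diff p glue (dglue p).
Proof.
move=> p0; have c i := is_diff_coord i p.
have ci := is_diffV p0 (c 0).
have c3 := is_diff_mul (c 0) (is_diff_mul (c 0) (c 0)).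
apply: (@is_diff_eq _ _ _ _ _ _ _ (is_diff_vec3 ci
  (is_diff_mul c3 (c 1)) (is_diff_mul ci (c 2)))).
by apply/funext => q; rewrite /dglue; congr vec3; field.
Qed.

Lemma jacobian_glue (p : C3) : p 0 0 != 0 ->
  'J glue p = \matrix_(i, j) dglue p 'e_i 0 j.
Proof.
move=> /is_diff_glue gp; apply/matrixP => i j.
by rewrite /jacobian [LHS]mxE [RHS]mxE diff_val.
Qed.

Lemma pdE (i : 'I_3) (f df : C3 -> C) (p : C3) :
  is_diff p f df -> pd i f p = df 'e_i.
Proof. by move=> fp; rewrite /pd deriveE ?diff_val. Qed.

(* The bivector field equal to f d_z /\ d_u1 on U and to
   h (v2 d_v1 /\ d_v2 - xi d_xi /\ d_v1) on V.  Under the change of coordinates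
   d_z = - xi^2 d_xi + 3 xi v1 d_v1 - xi v2 d_v2 and d_u1 = xi^-3 d_v1, so the
   two agree iff h = xi^-2 f; the V expression is thus determined by f. *)
Definition bivec_of (f h : C3 -> C) (b : bool) (p : C3) : 'M[C]_3 :=
  if b then f p *: wedge 0 1
  else h p *: (p 0 2 *: wedge 1 2 - p 0 0 *: wedge 0 1).

Lemma vec3_entry (x y z : C) (j : 'I_3) :
  vec3 x y z 0 j = x * (j == 0)%:R + y * (j == 1)%:R + z * (j == 2)%:R.
Proof.
rewrite /vec3 mxE; case: j => -[|[|[|//]]] hj /=;
  by rewrite !mulr0 mulr1 ?addr0 ?add0r.
Qed.

Lemma wedgeE (m n i j : 'I_3) : wedge m n i j =
  (i == m)%:R * (j == n)%:R - (i == n)%:R * (j == m)%:R.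
Proof. by rewrite /wedge !mxE -!natrM !mulnb. Qed.

Lemma delta_mxE (k j : 'I_3) : ('e_k : C3) 0 j = (k == j)%:R.
Proof. by rewrite mxE eqxx eq_sym. Qed.

Lemma push2_wedge (p : C3) (m n i j : 'I_3) : p 0 0 != 0 ->
  push2 glue p (wedge m n) i j =
  dglue p 'e_m 0 i * dglue p 'e_n 0 j - dglue p 'e_n 0 i * dglue p 'e_m 0 j.
Proof.
move=> p0; rewrite /push2 /wedge; set J := 'J glue p.
have JE k l : J k l = dglue p 'e_k 0 l by rewrite /J jacobian_glue // mxE.
have E k l : (J^T *m delta_mx k l *m J) i j = J k i * J l j.
  rewrite -(mul_delta_mx (0 : 'I_1)) mulmxA -mulmxA -rowE -colE.
  by rewrite mxE big_ord1 !mxE.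
rewrite mulmxBr mulmxBl -!JE -!E [LHS]mxE; congr (_ + _).
by rewrite [LHS]mxE.
Qed.

Section bivec_of.
Variables f h : C3 -> C.
Hypothesis f_diff : forall p : C3, differentiable f p.
Hypothesis h_diff : forall p : C3, differentiable h p.
Hypothesis fh : forall p : C3, p 0 0 != 0 -> h (glue p) = p 0 0 ^+ 2 * f p.

Lemma bivec_of_entry (b : bool) (p : C3) (i j : 'I_3) :
  is_diff p (fun q => bivec_of f h b q i j)
    (fun q => if b then 'd f p q * wedge 0 1 i j else
       h p * (q 0 2 * wedge 1 2 i j - q 0 0 * wedge 0 1 i j)
       + 'd h p q * (p 0 2 * wedge 1 2 i j - p 0 0 * wedge 0 1 i j)).
Proof.
have df : is_diff p f ('d f p) by apply: DiffDef.
have dh : is_diff p h ('d h p) by apply: DiffDef.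
have c k := is_diff_coord k p.
case: b; rewrite /bivec_of.
  have -> : (fun q => (f q *: wedge 0 1) i j) = (fun q => f q *: (wedge 0 1 i j : C^o)).
    by apply/funext => q; rewrite mxE.
  exact: (is_diffZl (wedge 0 1 i j : C^o) df).
have -> : (fun q : C3 => (h q *: (q 0 2 *: wedge 1 2 - q 0 0 *: wedge 0 1)) i j) =
  (fun q => h q * ((fun q => q 0 2 *: (wedge 1 2 i j : C^o)) - (fun q => q 0 0 *: (wedge 0 1 i j : C^o))) q).
  by apply/funext => q; rewrite !mxE.
have H := is_diff_mul dh (is_diffB (is_diffZl (wedge 1 2 i j : C^o) (c 2)) (is_diffZl (wedge 0 1 i j : C^o) (c 0))).
apply: (is_diff_eq H); apply/funext => q /=.
by congr (_ + _); rewrite mulrC.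
Qed.

Lemma bivec_of_holo (b : bool) (p : C3) : differentiable (bivec_of f h b) p.
Proof.
have c k := differentiable_coord p 0 k.
case: b; rewrite /bivec_of; first exact: differentiableZl.
rewrite (_ : (fun q : C3 => _) = (fun q => (h * (fun q => q 0 2 : C)) q *: wedge 1 2)
  - (fun q => (h * (fun q => q 0 0 : C)) q *: wedge 0 1)).
  by apply: differentiableB; apply: differentiableZl; apply: differentiableM.
by apply/funext => q; rewrite scalerBr !scalerA.
Qed.

Lemma wedge_skew (i j : 'I_3) : (wedge i j)^T = - wedge i j.
Proof. by rewrite /wedge linearB /= !trmx_delta opprB. Qed.

Lemma bivec_of_skew (b : bool) (p : C3) : (bivec_of f h b p)^T = - bivec_of f h b p.
Proof.
case: b; rewrite /bivec_of.
  by rewrite linearZ /= wedge_skew scalerN.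
rewrite -[RHS]scalerN opprB linearZ /= linearB !linearZ /= !wedge_skew.
by rewrite !scalerN opprK addrC.
Qed.

Lemma bivec_of_glue (b : bool) (p : C3) : p 0 0 != 0 ->
  bivec_of f h (~~ b) (glue p) = push2 glue p (bivec_of f h b p).
Proof.
move=> p0.
have fE : f (glue p) = p 0 0 ^+ 2 * h p.
  have -> : h p = (p 0 0)^-1 ^+ 2 * f (glue p).
    by rewrite -{1}(glueK p0) fh ?glue_neq0 // {1}/glue vec3E.
  by rewrite mulrA -exprMn divff // expr1n mul1r.
have hE := fh p0.
have pZ a A : push2 glue p (a *: A) = a *: push2 glue p A.
  by rewrite /push2 -scalemxAr -scalemxAl.
have pB A B : push2 glue p (A - B) = push2 glue p A - push2 glue p B.
  by rewrite /push2 mulmxBr mulmxBl.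
have entM : (forall (a : C) (A : 'M[C]_3) (m n : 'I_3), (a *: A) m n = a * A m n)
    * (forall (A B : 'M[C]_3) (m n : 'I_3), (A - B) m n = A m n - B m n).
  by split=> *; rewrite !mxE.
have := fun m n i j => push2_wedge m n i j p0.
rewrite /bivec_of; move: wedge wedgeE => w wE pw.
apply/matrixP => i j; case: b; rewrite /= !pZ.
  rewrite !entM pw // hE /glue !vec3E /dglue.
  by rewrite !vec3_entry !wE !delta_mxE /=; field.
rewrite pB !pZ !entM !pw // fE /dglue.
by rewrite !vec3_entry !wE !delta_mxE /=; field.
Qed.

Lemma bivec_of_jacobi (b : bool) (p : C3) (i j k : 'I_3) :
    \sum_(l < 3)
      (bivec_of f h b p i l * pd l (fun q => bivec_of f h b q j k) p
     + bivec_of f h b p j l * pd l (fun q => bivec_of f h b q k i) p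
     + bivec_of f h b p k l * pd l (fun q => bivec_of f h b q i j) p) = 0.
Proof.
under eq_bigr => l _ do rewrite !(pdE _ (bivec_of_entry _ _ _ _)).
have entM : (forall (a : C) (A : 'M[C]_3) (m n : 'I_3), (a *: A) m n = a * A m n)
    * (forall (A B : 'M[C]_3) (m n : 'I_3), (A - B) m n = A m n - B m n).
  by split=> *; rewrite !mxE.
rewrite !big_ord_recl big_ord0 /bivec_of; move: wedge wedgeE => w wE.
by case: b; rewrite !entM !wE ?delta_mxE /=; ring.
Qed.

Definition poisson_of : poisson :=
  Poisson bivec_of_holo bivec_of_skew bivec_of_glue bivec_of_jacobi.

End bivec_of.

Lemma diff_u1 (p : C3) : differentiable (fun q : C3 => q 0 1 : C) p.
Proof. exact: differentiable_coord. Qed.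

Lemma diff_coordM (i j : 'I_3) (p : C3) :
  differentiable (fun q : C3 => q 0 i * q 0 j : C) p.
Proof. by apply: differentiableM; exact: differentiable_coord. Qed.

Lemma fh_e7 (p : C3) : p 0 0 != 0 ->
  glue p 0 0 * glue p 0 1 = p 0 0 ^+ 2 * p 0 1.
Proof. by move=> p0; rewrite /glue !vec3E; field. Qed.

Lemma fh_e8 (p : C3) : p 0 0 != 0 ->
  glue p 0 1 = p 0 0 ^+ 2 * (p 0 0 * p 0 1).
Proof. by move=> p0; rewrite /glue !vec3E; ring. Qed.

Lemma fh_e13 (p : C3) : p 0 0 != 0 ->
  glue p 0 1 * glue p 0 2 = p 0 0 ^+ 2 * (p 0 1 * p 0 2).
Proof. by move=> p0; rewrite /glue !vec3E; field. Qed.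

(* With p = (z, u1, u2) in U:  u1 d_z /\ d_u1,  z u1 d_z /\ d_u1  and
   u1 u2 d_z /\ d_u1. *)
Definition e7 : poisson :=
  @poisson_of (fun p => p 0 1) (fun p => p 0 0 * p 0 1)
    diff_u1 (diff_coordM 0 1) fh_e7.

Definition e8 : poisson :=
  @poisson_of (fun p => p 0 0 * p 0 1) (fun p => p 0 1)
    (diff_coordM 0 1) diff_u1 fh_e8.

Definition e13 : poisson :=
  @poisson_of (fun p => p 0 1 * p 0 2) (fun p => p 0 1 * p 0 2)
    (diff_coordM 1 2) (diff_coordM 1 2) fh_e13.

Lemma e7_U (p : C3) : e7 true p = p 0 1 *: wedge 0 1.
Proof. by []. Qed.

Lemma e8_U (p : C3) : e8 true p = (p 0 0 * p 0 1) *: wedge 0 1.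
Proof. by []. Qed.

Lemma e13_U (p : C3) : e13 true p = (p 0 1 * p 0 2) *: wedge 0 1.
Proof. by []. Qed.

End W3.

(* Typing R[i] as a numFieldType gives it the topology and the normed module
   structure that MathComp-Analysis puts on such fields, so that
   [differentiable] on C^3 means complex differentiable. *)
Definition Cplx (R : realType) : numFieldType := R[i].

(* Main.v *)
From mathcomp Require Import all_boot all_order all_algebra.
From mathcomp Require Import complex.
From mathcomp Require Import all_classical all_reals all_analysis.
Require Import Defs.

Set Implicit Arguments.
Unset Strict Implicit.
Unset Printing Implicit Defensive.

Import Order.TTheory GRing.Theory Num.Theory.
Import numFieldNormedType.Exports.

Local Open Scope classical_set_scope.
Local Open Scope ring_scope.
Local Open Scope quotient_scope.

(** The three structures are told apart by their zero loci.  Write S for the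
surface u1 = 0 (the total space of O(1)), F_0 and F_oo for the fibres z = 0 and
xi = 0 over P^1, and T for the surface u2 = 0 (the total space of O(-3)).  The
zero loci of e7, e8 and e13 are

  S u F_oo,   S u F_0 u {xi = v2 = 0}   and   S u T.

Since the differential of an isomorphism phi is invertible ([jacobian_cancel]),
phi carries the zero locus of one structure bijectively onto that of the other
([poisson_isomorphic_zeros]).  Moreover, if a coordinate line through p lies in
the zero locus at the source, its image under the differential at p satisfies
every linear equation x_k = 0 that holds on the zero locus at the target near
phi(p) ([tangent_entry]).

Near the point (xi, v1, v2) = (0, 1, 0) the zero locus of e8 is a line, whereas
every zero of e7 or e13 lies on two different coordinate lines made of zeros.
An invertible differential cannot send two independent vectors into one line,
so e8 is isomorphic to neither ([no_isolated_line]).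

The zero loci of e7 and e13 are both unions of two smooth surfaces crossing
normally along a curve.  The crossing curve is characterised by tangent vectors:
all three coordinate lines through a crossing point consist of zeros, while at
any other zero some chart shows the locus, near that zero, inside a coordinate
plane; a zero of the first kind cannot be sent to one of the second kind, as its
tangent vectors span the tangent space ([crossing_image]).  Hence an isomorphism
from e7 to e13 matches the crossing curves, which are the affine line S n F_oo
and the projective line S n T.  The first is not compact and the second is: the
coordinate v2 on S n F_oo, pulled back to S n T, has bounded real part, because
S n T is covered by two closed unit discs, but it takes every complex value
([e7_e13_not_iso]). *)

(** * Lines and invertible matrices *)

Lemma line_continuous (C : numFieldType) (V : normedModType C) (p v : V) :
  continuous (fun t : C => p + t *: v).
Proof.
move=> t; have c : {for t, continuous (cst p : C -> V)} by apply: cst_continuous.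
have s : {for t, continuous (fun x : C => x *: v)} by exact: scalel_continuous.
exact: (continuousD c s).
Qed.

Lemma parallel_rows (R : fieldType) n (J K : 'M[R]_n) (i j m : 'I_n) :
  i != j -> J *m K = 1%:M ->
  (forall k, k != m -> J i k = 0) -> (forall k, k != m -> J j k = 0) -> False.
Proof.
move=> ij JK Ji Jj.
have E l k : (forall c, c != m -> J l c = 0) -> (l == k)%:R = J l m * K m k.
  move=> Jl; transitivity ((1%:M : 'M[R]_n) l k); first by rewrite mxE.
  rewrite -JK mxE (bigD1 m) //= big1 ?addr0 // => c cm.
  by rewrite Jl // mul0r.
have := E i j Ji; rewrite (negbTE ij) => /esym/eqP; rewrite mulf_eq0.
case/orP => /eqP e0.
  by have /eqP := E i i Ji; rewrite e0 mul0r eqxx oner_eq0.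
by have /eqP := E j j Jj; rewrite e0 mulr0 eqxx oner_eq0.
Qed.

Lemma zero_col (R : fieldType) n (J K : 'M[R]_n) (k : 'I_n) :
  K *m J = 1%:M -> (forall i, J i k = 0) -> False.
Proof.
move=> /matrixP/(_ k k)/eqP KJ Jk; move: KJ.
by rewrite !mxE big1 ?eqxx 1?eq_sym ?oner_eq0 // => i _; rewrite Jk mulr0.
Qed.

(** * Charts *)

Section Geometry.
Variable C : numFieldType.
Local Notation C3 := 'rV[C]_3.
Local Notation W := (W3 C).
Local Notation incl := (@incl C).

Lemma open_neq0 : open [set x : C | x != 0].
Proof.
have -> : [set x : C | x != 0] = ~` [set 0].
  by apply/seteqP; split=> x /= /eqP.
apply: closed_openC.
exact: (accessible_closed_set1 (hausdorff_accessible (@norm_hausdorff _ C))).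
Qed.

(** The quotient map identifies no more points than [glue] does. *)
Lemma incl_eq (a b : bool) (p q : C3) : incl a p = incl b q ->
  (a = b /\ p = q) \/ [/\ b = ~~ a, p 0 0 != 0 & q = glue p].
Proof.
move=> /eqquotP; rewrite /= /glued /=.
case: ifP => [/eqP -> /eqP ->|ab /andP[p0 /eqP ->]]; first by left.
by right; split=> //; case: a b ab => -[].
Qed.

Lemma incl_continuous (b : bool) : continuous (incl b).
Proof.
move=> p; apply: (@continuous_comp _ _ _ (existT (fun=> C3) b)
  (\pi_(quotient_topology {eq_quot @glued C}))).
  exact: existT_continuous.
exact: pi_continuous.
Qed.

Lemma open_chart (b : bool) : open (range (incl b)).
Proof.
suff : open (\pi_(quotient_topology {eq_quot @glued C}) @^-1` range (incl b)) by [].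
apply/sigT_openP => a.
have [->|ab] := eqVneq a b.
  rewrite (_ : _ @^-1` _ = setT); first exact: openT.
  by apply/seteqP; split=> // p _; exists p.
rewrite (_ : _ @^-1` _ = (fun p : C3 => p 0 0) @^-1` [set x | x != 0]).
  apply: open_comp => [p _|]; first exact: coord_continuous.
  exact: open_neq0.
apply/seteqP; split=> p /=.
  move=> [q _ /incl_eq[[ba]|[_ q0 ->]]]; first by rewrite ba eqxx in ab.
  by rewrite glue_neq0.
move=> p0; exists (glue p) => //.
by have := incl_glue a p0; case: a b ab {p0} => -[].
Qed.

(** What makes local expressions legitimate: near p the image does not leave the
chart b, so that [coord b] takes no junk value there. *)
Lemma near_chart (phi : W -> W) (a b : bool) (p q : C3) :
  continuous phi -> phi (incl a p) = incl b q ->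
  \forall x \near p, range (incl b) (phi (incl a x)).
Proof.
move=> cphi pq; have c : {for p, continuous (phi \o incl a)}.
  by apply: continuous_comp; [exact: incl_continuous | exact: cphi].
apply: c; apply: open_nbhs_nbhs; split; first exact: open_chart.
by exists q; rewrite //= pq.
Qed.

Lemma coordK (b : bool) (w : W) : range (incl b) w -> incl b (coord b w) = w.
Proof. by move=> [p _ <-]; rewrite inclK. Qed.

(** Expression of a self-map of W_3 in the chart a at the source and b at the
target; it is a junk value at points whose image leaves the chart b. *)
Definition in_charts (a b : bool) (phi : W -> W) : C3 -> C3 :=
  coord b \o phi \o incl a.

Lemma in_chartsE a b phi p q :
  phi (incl a p) = incl b q -> in_charts a b phi p = q.
Proof. by rewrite /in_charts /= => ->; rewrite inclK. Qed.

Lemma in_charts_differentiable a b phi p q : holomorphic phi ->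
  phi (incl a p) = incl b q -> differentiable (in_charts a b phi) p.
Proof. by move=> [_ dphi] pq; apply: dphi; rewrite pq; exists q. Qed.

(** The chain rule for psi o phi = id.  Jacobians act on row vectors, hence the
order of the product. *)
Lemma jacobian_cancel (phi psi : W -> W) (a b : bool) (p q : C3) :
  holomorphic phi -> holomorphic psi -> cancel phi psi ->
  phi (incl a p) = incl b q ->
  'J (in_charts a b phi) p *m 'J (in_charts b a psi) q = 1%:M.
Proof.
move=> hphi hpsi K pq.
have qp : psi (incl b q) = incl a p by rewrite -pq K.
have df := in_charts_differentiable hphi pq.
have dg := in_charts_differentiable hpsi qp.
(* Away from p, phi may leave the chart b, and then this equation fails. *)
have E : \forall x \near p, (in_charts b a psi \o in_charts a b phi) x = id x.
  near=> x; rewrite /in_charts /= coordK ?K ?inclK //.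
  by near: x; exact: near_chart (proj1 hphi) pq.
rewrite -(in_chartsE pq) in dg *.
apply/row_matrixP => i; rewrite !rowE mulmxA mulmx1.
rewrite -deriveEjacobian // -deriveEjacobian //.
rewrite (deriveE _ df) (deriveE _ dg).
have D : 'D_('e_i) (in_charts b a psi \o in_charts a b phi) p = 'e_i.
  by rewrite (near_eq_derive _ E) derive_id.
rewrite -[RHS]D [RHS](deriveE _ (differentiable_comp df dg)).
exact/esym/(congr1 (fun h => h 'e_i) (diff_comp df dg)).
Unshelve. all: by end_near. Qed.

(** * Zero loci and their tangent directions *)

Definition zeros (pi : poisson C) : set W :=
  [set w | exists b p, w = incl b p /\ pi b p = 0].

(** The zero locus may be computed in any chart, bivectors being transformed
linearly by the change of coordinates. *)
Lemma zeros_incl (pi : poisson C) b p : zeros pi (incl b p) <-> pi b p = 0.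
Proof.
split=> [[a [q [/incl_eq[[-> ->] //|[-> p0 ->]]]]]|]; last by exists b, p.
have g0 : glue p 0 0 != 0 by rewrite glue_neq0.
have := poisson_glue pi (~~ b) g0; rewrite negbK glueK // => -> ->.
by rewrite /push2 mulmx0 mul0mx.
Qed.

Lemma congruence_eq0 (J K A : 'M[C]_3) :
  J *m K = 1%:M -> J^T *m A *m J = 0 -> A = 0.
Proof.
move=> JK JAJ; have KJ : K^T *m J^T = 1%:M by rewrite -trmx_mul JK trmx1.
have <- : K^T *m (J^T *m A *m J) *m K = A.
  by rewrite !mulmxA KJ mul1mx -mulmxA JK mulmx1.
by rewrite JAJ mulmx0 mul0mx.
Qed.

(** What an isomorphism remembers about zero loci.  Both maps are arguments, so
that exchanging them exchanges the two structures. *)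
Definition zeros_iso (phi psi : W -> W) (pi pi' : poisson C) : Prop :=
  [/\ holomorphic phi, holomorphic psi, cancel phi psi, cancel psi phi &
      forall w, zeros pi' (phi w) <-> zeros pi w].

Lemma zeros_iso_sym phi psi pi pi' :
  zeros_iso phi psi pi pi' -> zeros_iso psi phi pi' pi.
Proof. by move=> [? ? ? K Z]; split=> // w; rewrite -Z K. Qed.

Lemma poisson_isomorphic_zeros pi pi' : poisson_isomorphic pi pi' ->
  exists phi psi, zeros_iso phi psi pi pi'.
Proof.
move=> [phi [[hphi [psi [hpsi K K']]] push]]; exists phi, psi; split=> // w.
have [a [p ->]] := incl_repr w; have [b [q pq]] := incl_repr (phi (incl a p)).
have r : range (incl b) (phi (incl a p)) by rewrite pq; exists q.
rewrite pq !zeros_incl -(in_chartsE pq) (push _ _ _ r).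
split=> [|->]; last by rewrite /push2 mulmx0 mul0mx.
exact: (congruence_eq0 (jacobian_cancel hphi hpsi K pq)).
Qed.

(** Straight lines parallel to the axes give enough tangent vectors of the zero
loci under study, and they make all curves explicit. *)
Definition zero_axis (pi : poisson C) a (p : C3) (i : 'I_3) : Prop :=
  forall t, pi a (p + t *: 'e_i) = 0.

Definition two_zero_axes (pi : poisson C) : Prop :=
  forall a p, pi a p = 0 ->
    exists i j, [/\ i != j, zero_axis pi a p i & zero_axis pi a p j].

Lemma derive_line_eq0 (f : C3 -> C3) (p v : C3) (k : 'I_3) :
  differentiable f p -> (\forall t \near 0, f (p + t *: v) 0 k = 0) ->
  ('D_v f p) 0 k = 0.
Proof.
move=> df f0; have ck := is_diff_coord k (f p).
pose F := (fun x : C3 => x 0 k) \o f.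
have dk : differentiable (fun x : C3 => x 0 k : C) (f p).
  exact: differentiable_coord.
have dF : differentiable F p := differentiable_comp df dk.
have -> : ('D_v f p) 0 k = 'D_v F p.
  rewrite [RHS](deriveE _ dF) (deriveE _ df).
  have -> : 'd F p v = 'd (fun x : C3 => x 0 k : C) (f p) ('d f p v).
    exact: (congr1 (fun h => h v) (diff_comp df dk)).
  by rewrite diff_val.
rewrite /derive; apply: cvg_lim => //.
have F0 : F p = 0 by move: (nbhs_singleton f0); rewrite scale0r addr0.
apply: (@cvg_trans _ ((fun=> 0 : C) @ (0 : C)^')); last exact: cvg_cst.
apply: near_eq_cvg; apply: cvg_within; near=> t.
rewrite /= F0 subr0 addrC /F /=.
have -> : f (p + t *: v) 0 k = 0 by near: t.
by rewrite scaler0.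
Unshelve. all: by end_near. Qed.

(** The i-th row of the Jacobian is the velocity of the image of the coordinate
line in direction i.  That image consists of zeros of pi', along which x_k
vanishes near q, so the velocity has no k-th component. *)
Lemma tangent_entry phi psi pi pi' a b p q i k :
  zeros_iso phi psi pi pi' -> phi (incl a p) = incl b q ->
  zero_axis pi a p i -> (\forall x \near q, pi' b x = 0 -> x 0 k = 0) ->
  'J (in_charts a b phi) p i k = 0.
Proof.
move=> [hphi hpsi K _ Z] pq ax nk.
have df := in_charts_differentiable hphi pq.
have -> : 'J (in_charts a b phi) p i k = ('D_('e_i) (in_charts a b phi) p) 0 k.
  by rewrite deriveEjacobian // -rowE [RHS]mxE.
apply: derive_line_eq0 => //.
have line : (p + t *: 'e_i) @[t --> (0 : C)] --> p.
  by have := @line_continuous _ C3 p 'e_i 0; rewrite /continuous_at scale0r addr0.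
have fq : in_charts a b phi x @[x --> p] --> q.
  by rewrite -(in_chartsE pq); exact: differentiable_continuous.
have near_p : \forall x \near p, range (incl b) (phi (incl a x)) /\
    (pi' b (in_charts a b phi x) = 0 -> in_charts a b phi x 0 k = 0).
  exact: (filterI (near_chart (proj1 hphi) pq) (fq _ nk)).
near=> t.
have [r] : range (incl b) (phi (incl a (p + t *: 'e_i))) /\
    (pi' b (in_charts a b phi (p + t *: 'e_i)) = 0 ->
     in_charts a b phi (p + t *: 'e_i) 0 k = 0).
  by near: t; exact: (line _ near_p).
apply.
by apply/zeros_incl; rewrite /in_charts /= coordK // Z; apply/zeros_incl.
Unshelve. all: by end_near. Qed.

(** If the zeros of pi' near q all lie on the line in direction m, then rows i and
j of the Jacobian are both multiples of 'e_m, so it cannot be invertible. *)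
Lemma no_isolated_line phi psi pi pi' b (q : C3) (m : 'I_3) :
  zeros_iso phi psi pi pi' ->
  two_zero_axes pi -> pi' b q = 0 ->
  ~ (forall k, k != m -> \forall x \near q, pi' b x = 0 -> x 0 k = 0).
Proof.
move=> iso axes q0 line.
have [hphi hpsi K K' Z] := iso.
have [a [p qp]] := incl_repr (psi (incl b q)).
have pq : phi (incl a p) = incl b q by rewrite -qp K'.
have p0 : pi a p = 0 by apply/zeros_incl; rewrite -Z pq; apply/zeros_incl.
have [i [j [ij axi axj]]] := axes _ _ p0.
apply: (parallel_rows ij (jacobian_cancel hphi hpsi K pq) (m := m)) => k km.
  exact: (tangent_entry iso pq axi (line k km)).
exact: (tangent_entry iso pq axj (line k km)).
Qed.

(** Otherwise the k-th column of the Jacobian would vanish. *)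
Lemma crossing_image phi psi pi pi' a b p q k :
  zeros_iso phi psi pi pi' -> phi (incl a p) = incl b q ->
  (forall i, zero_axis pi a p i) ->
  ~ (\forall x \near q, pi' b x = 0 -> x 0 k = 0).
Proof.
move=> iso pq ax nk; have [hphi hpsi K K' _] := iso.
have qp : psi (incl b q) = incl a p by rewrite -pq K.
apply: (zero_col (jacobian_cancel hpsi hphi K' qp) (k := k)) => i.
exact: (tangent_entry iso pq (ax i) nk).
Qed.

Lemma near_coord_neq0 (q : C3) i :
  q 0 i != 0 -> \forall x \near q, (x : C3) 0 i != 0.
Proof.
move=> qi; have ci : {for q, continuous (fun x : C3 => x 0 i)}.
  exact: coord_continuous.
have nq : nbhs (q 0 i) [set x : C | x != 0].
  by apply: open_nbhs_nbhs; split; [exact: open_neq0|].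
exact: (ci _ nq).
Qed.

(** If q_i != 0 then the zeros near q lie in the plane x_j = 0, which
[crossing_image] forbids. *)
Lemma crossing_coord phi psi pi pi' a b p q i j :
  zeros_iso phi psi pi pi' -> phi (incl a p) = incl b q ->
  (forall l, zero_axis pi a p l) ->
  (forall x, pi' b x = 0 -> x 0 i = 0 \/ x 0 j = 0) -> q 0 i = 0.
Proof.
move=> iso pq ax ij; apply/eqP/negPn/negP => qi.
apply: (crossing_image (k := j) iso pq ax).
by apply: filterS (near_coord_neq0 qi) => x xi /ij[] // /eqP; rewrite (negbTE xi).
Qed.

(** * The zero loci of e7, e8 and e13 *)

Lemma bivec_of_eq0 (f h : C3 -> C) (b : bool) (p : C3) :
  bivec_of f h b p = 0 <->
  if b then f p = 0 else h p = 0 \/ (p 0 0 = 0 /\ p 0 2 = 0).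
Proof.
case: b; rewrite /bivec_of; split.
- by move=> /matrixP/(_ 0 1); rewrite !mxE /= subr0 mulr1.
- by move=> ->; rewrite scale0r.
- move=> E; have [->|h0] := eqVneq (h p) 0; first by left.
  right; split; apply/eqP.
    move: E => /matrixP/(_ 0 1)/eqP; rewrite !mxE /= !(subr0, mulr0, mulr1, sub0r).
    by rewrite mulf_eq0 (negbTE h0) oppr_eq0.
  move: E => /matrixP/(_ 1 2)/eqP; rewrite !mxE /= !(subr0, mulr0, mulr1).
  by rewrite mulf_eq0 (negbTE h0).
- by case=> [->|[-> ->]]; rewrite ?scale0r // subrr scaler0.
Qed.

Lemma axis_coord (p : C3) (t : C) (i j : 'I_3) :
  i != j -> (p + t *: 'e_i) 0 j = p 0 j.
Proof. by move=> ij; rewrite !mxE [j == i]eq_sym (negbTE ij) andbF mulr0 addr0. Qed.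

Lemma e7_axes : two_zero_axes (e7 C).
Proof.
move=> a p; case: a => /bivec_of_eq0 /=.
  by move=> p1; exists 0, 2; split=> // t; apply/bivec_of_eq0; rewrite axis_coord.
move=> E; have : p 0 0 = 0 \/ p 0 1 = 0.
  by case: E => [/eqP|[-> _]]; [rewrite mulf_eq0 => /orP[]/eqP|]; auto.
case=> p0; [exists 1, 2|exists 0, 2]; split=> // t; apply/bivec_of_eq0; left;
  by rewrite (axis_coord _ _ (j := 0)) // p0 mul0r ||
     rewrite (axis_coord _ _ (j := 1)) // p0 mulr0.
Qed.

Lemma e13_zeros b p : e13 C b p = 0 <-> p 0 1 = 0 \/ p 0 2 = 0.
Proof.
have M : p 0 1 * p 0 2 = 0 <-> p 0 1 = 0 \/ p 0 2 = 0.
  split=> [/eqP|[]->]; rewrite ?mul0r ?mulr0 // mulf_eq0.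
  by case/orP => /eqP; auto.
case: b; split.
- by move=> /bivec_of_eq0 /M.
- by move=> /M ?; apply/bivec_of_eq0.
- by move=> /bivec_of_eq0 [/M//|[_ ->]]; right.
- by move=> /M ?; apply/bivec_of_eq0; left.
Qed.

Lemma e13_axes : two_zero_axes (e13 C).
Proof.
move=> a p; case/e13_zeros => p0; [exists 0, 2|exists 0, 1]; split=> // t;
  apply/e13_zeros;
  by [left; rewrite axis_coord | right; rewrite axis_coord].
Qed.

Lemma ord3_cases (P : 'I_3 -> Prop) : P 0 -> P 1 -> P 2 -> forall i, P i.
Proof.
move=> P0 P1 P2 [[|[|[|//]]] hi];
  [move: P0 | move: P1 | move: P2]; by congr P; exact: val_inj.
Qed.

(** In the chart V, e8 is v1 (v2 d_v1 /\ d_v2 - xi d_xi /\ d_v1), and v1 is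
invertible near v1 = 1. *)
Lemma e8_line k : k != 1 ->
  \forall x \near vec3 0 (1 : C) 0, e8 C false x = 0 -> x 0 k = 0.
Proof.
move=> k1; have p1 : vec3 0 (1 : C) 0 0 1 != 0 by rewrite vec3E oner_eq0.
apply: filterS (near_coord_neq0 p1) => x x1 /bivec_of_eq0 /= [/eqP|[]].
  by rewrite (negbTE x1).
by move: k k1; apply: ord3_cases.
Qed.

Lemma e8_not_iso (pi : poisson C) phi psi :
  two_zero_axes pi -> ~ zeros_iso phi psi pi (e8 C).
Proof.
move=> axes iso; apply: (no_isolated_line iso axes _ e8_line).
by apply/bivec_of_eq0; right; rewrite !vec3E.
Qed.

Lemma e7_crossing t l : zero_axis (e7 C) false (vec3 0 0 t) l.
Proof.
move=> s; apply/bivec_of_eq0; left; have [->|l0] := eqVneq l 0.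
  by rewrite [X in _ * X]axis_coord // !vec3E mulr0.
by rewrite [X in X * _]axis_coord // !vec3E mul0r.
Qed.

Lemma e13_crossing b z l : zero_axis (e13 C) b (vec3 z 0 0) l.
Proof.
move=> s; apply/e13_zeros; have [->|l1] := eqVneq l 1.
  by right; rewrite axis_coord // !vec3E.
by left; rewrite axis_coord // !vec3E.
Qed.

(** The image of the crossing curve xi = v1 = 0 of e7 lies in the crossing curve
of e13, which has the same equations in both charts. *)
Lemma crossing_e13 phi psi t b q : zeros_iso phi psi (e7 C) (e13 C) ->
  phi (incl false (vec3 0 0 t)) = incl b q -> q = vec3 (q 0 0) 0 0.
Proof.
move=> iso pq; have ax := e7_crossing t.
rewrite {1}[q]vec3_eta; congr vec3.
  exact: (crossing_coord iso pq ax (fun x => proj1 (e13_zeros b x))).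
apply: (crossing_coord (j := 1) iso pq ax) => x /e13_zeros[]; auto.
Qed.

(** The crossing curve of e7 avoids the chart U, where the zero locus is the
smooth surface u1 = 0. *)
Lemma crossing_e7 phi psi b z : zeros_iso phi psi (e7 C) (e13 C) ->
  range (incl false) (psi (incl b (vec3 z 0 0))).
Proof.
move=> /zeros_iso_sym iso.
have [[] [q pq]] := incl_repr (psi (incl b (vec3 z 0 0))).
  have smooth : \forall x \near q, e7 C true x = 0 -> x 0 1 = 0.
    by near=> x => /bivec_of_eq0.
  by case: (crossing_image iso pq (e13_crossing b z) smooth).
by rewrite pq; exists q.
Unshelve. all: by end_near. Qed.

End Geometry.

(** * The affine line is not the projective line *)

(** In either chart the crossing curve of e13 consists of the points (z, 0, 0),
and the gluing acts on them as z |-> z^-1. *)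
Lemma zero_section_discs (C : numFieldType) b (z : C) :
  exists b' z', `|z'| <= 1 /\ incl b (vec3 z 0 0) = incl b' (vec3 z' 0 0).
Proof.
have [z1|z1] := real_leP (normr_real z) (real1 C); first by exists b, z.
have z0 : z != 0 by rewrite -normr_gt0 (lt_trans ltr01).
exists (~~ b), z^-1; split; first by rewrite normfV invf_le1 ?ltW // normr_gt0.
rewrite -incl_glue ?vec3E //; congr incl.
by rewrite /glue !vec3E !mulr0.
Qed.

(** The disc lies in the square [-1, 1] x [-1, 1] of R x R, which is compact. *)
Lemma Re_bounded_unit_disc (R : realType) (g : Cplx R -> Cplx R) :
  continuous g ->
  exists M : R, forall z : Cplx R, `|z| <= 1 -> complex.Re (g z) <= M.
Proof.
move=> cg.
pose c (x : R * R) : Cplx R := Complex x.1 x.2.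
have normR (x : R) : `|(Complex x 0 : Cplx R)| = Complex `|x| 0 :> Cplx R.
  by rewrite normc_def /= expr0n /= addr0 sqrtr_sqr.
have normI (x : R) : `|(Complex 0 x : Cplx R)| = Complex `|x| 0 :> Cplx R.
  by rewrite normc_def /= expr0n /= add0r sqrtr_sqr.
have cc : continuous c.
  move=> x; have f1 : y.1 @[y --> x] --> x.1 by exact: cvg_fst.
  have f2 : y.2 @[y --> x] --> x.2 by exact: cvg_snd.
  apply/cvgrPdist_lt => -[e e'].
  rewrite ltcE /= => /andP[/eqP -> e0]; near=> y.
  have -> : c x - c y = Complex (x.1 - y.1) 0 + Complex 0 (x.2 - y.2).
    by apply/eqP; rewrite eq_complex /= addr0 add0r !eqxx.
  apply: le_lt_trans (ler_normD _ _) _; rewrite normR normI.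
  rewrite ltcE /= addr0 eqxx /= [e]splitr.
  apply: ltrD; near: y.
    by move/cvgrPdist_lt: (f1); apply; rewrite divr_gt0.
  by move/cvgrPdist_lt: (f2); apply; rewrite divr_gt0.
have cRe : continuous (fun z : Cplx R => complex.Re z).
  move=> z A /nbhs_ballP[e /= e0 eA].
  have e0' : 0 < (Complex e 0 : Cplx R) by rewrite ltcE /= eqxx.
  apply/nbhs_ballP; exists (Complex e 0) => //= w.
  rewrite /ball /= => zw; apply: eA; rewrite /ball /=.
  have := le_lt_trans (normc_ge_Re (z - w)) zw.
  by rewrite ltcR; case: z w {zw} => [? ?] [? ?].
pose h := (fun z : Cplx R => complex.Re z) \o g \o c.
have ch : continuous h.
  move=> x; have cgx := continuous_comp (cc x) (cg (c x)).
  exact: (continuous_comp cgx (cRe _)).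
have K : compact (`[-1, 1] `*` `[-1, 1] : set (R * R)).
  by apply: compact_setX; exact: segment_compact.
have /compact_bounded[M [_ HM]] : compact (h @` (`[-1, 1] `*` `[-1, 1])).
  by apply: continuous_compact => //; exact: continuous_subspaceT.
exists (M + 1) => -[x y] z1.
have xy : `|x| <= 1 /\ `|y| <= 1.
  have sqrt1 : Num.sqrt (x ^+ 2 + y ^+ 2) <= 1.
    by move: z1; rewrite normc_def lecE /= eqxx.
  by split; rewrite -sqrtr_sqr; apply: le_trans sqrt1; apply: ler_wsqrtr;
    rewrite (lerDl, lerDr) sqr_ge0.
have M1 : M < M + 1 by rewrite ltrDl.
apply: le_trans (ler_norm _) (HM _ M1 (h (x, y)) _).
by exists (x, y) => //=; rewrite !in_itv /= -!ler_norml.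
Unshelve. all: by end_near. Qed.

(** The coordinate v2 of psi on the crossing curve of e13 is continuous on the two
closed unit discs covering that curve, so its real part is at most some M;
yet it equals M + 1 at the image of (0, 0, M + 1) under phi. *)
Lemma e7_e13_not_iso (R : realType) phi psi :
  ~ zeros_iso phi psi (e7 (Cplx R)) (e13 (Cplx R)).
Proof.
move=> iso; set C := Cplx R in iso *; have [hphi hpsi K K' _] := iso.
pose g b (z : C) : C := in_charts b false psi (vec3 z 0 0) 0 2.
have cg b : continuous (g b).
  move=> z; have [q _ qz] := crossing_e7 b z iso.
  have cv : {for z, continuous (fun z : C => vec3 z 0 0)}.
    have -> : (fun z : C => vec3 z 0 0) = (fun z : C => 0 + z *: vec3 1 0 0).
      apply/funext => w; rewrite add0r [RHS]vec3_eta !mxE /=.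
      by rewrite !mulr0 mulr1.
    exact: line_continuous.
  have cf := differentiable_continuous (in_charts_differentiable hpsi (esym qz)).
  have cp : {for in_charts b false psi (vec3 z 0 0),
      continuous (fun p : 'rV[C]_3 => p 0 2)} by exact: coord_continuous.
  exact: (continuous_comp (continuous_comp cv cf) cp).
have [M0 B0] := Re_bounded_unit_disc (cg false).
have [M1 B1] := Re_bounded_unit_disc (cg true).
have B b z : `|z| <= 1 -> complex.Re (g b z) <= Num.max M0 M1.
  by case: b => z1; rewrite le_max ?B0 ?B1 ?orbT.
pose t : C := Complex (Num.max M0 M1 + 1) 0.
have gt b z : incl b (vec3 z 0 0) = phi (incl false (vec3 0 0 t)) -> g b z = t.
  by move=> pq; rewrite /g /in_charts /= pq K inclK vec3E.
have [b [q pq]] := incl_repr (phi (incl false (vec3 0 0 t))).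
have tM : ~ complex.Re t <= Num.max M0 M1.
  by rewrite /= gerDl ler10.
have qE := crossing_e13 iso pq.
have [b' [z [z1 E]]] := zero_section_discs b (q 0 0).
by apply: tM; rewrite -(gt b' z) ?B // -E -qE pq.
Qed.

Theorem lemma5p9 (R : realType) :
  [/\ ~ poisson_isomorphic (e7 (Cplx R)) (e8 (Cplx R)),
      ~ poisson_isomorphic (e7 (Cplx R)) (e13 (Cplx R)) &
      ~ poisson_isomorphic (e8 (Cplx R)) (e13 (Cplx R))].
Proof.
split=> /poisson_isomorphic_zeros[phi [psi iso]].
- exact: (e8_not_iso (@e7_axes _) iso).
- exact: (e7_e13_not_iso iso).
- exact: (e8_not_iso (@e13_axes _) (zeros_iso_sym iso)).
Qed.
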